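(* Let $H_d$ denote the $d$-dimensional hypercube graph. Then $\mathrm{cub}(H_d) = \Theta\left(\frac{d}{\log d}\right)$ as $d \to \infty$; that is, there exist constants $c_1, c_2 > 0$ and an integer $d_0 \ge 2$ such that for all integers $d \ge d_0$, $c_1 \frac{d}{\log d} \le \mathrm{cub}(H_d) \le c_2 \frac{d}{\log d}$.
   Context: The $d$-dimensional hypercube $H_d$ is the graph whose vertices correspond to the $2^d$ binary strings of length $d$, two vertices being adjacent if and only if the corresponding strings differ in exactly one bit position. A $k$-dimensional (axis-parallel) cube is a Cartesian product $R_1 \times R_2 \times \cdots \times R_k$ where each $R_i$ is a closed interval of the form $[a_i, a_i+1]$ on the real line. A finite simple graph $G$ is representable as the intersection graph of a family of sets $(S_x)_{x \in V(G)}$ if two distinct vertices $x,y$ are adjacent in $G$ if and only if $S_x \cap S_y \neq \emptyset$. The cubicity $\mathrm{cub}(G)$ is the minimum $k$ such that $G$ is representable as the intersection graph of axis-parallel cubes in $k$-dimensional space. *)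

(* Defs.v *)
From HB Require Import structures.
From mathcomp Require Import all_boot all_order all_algebra.
From mathcomp Require Import all_classical all_reals all_analysis.
Set Implicit Arguments.
Unset Strict Implicit.
Unset Printing Implicit Defensive.
Import Order.TTheory GRing.Theory Num.Theory.
Local Open Scope classical_set_scope.
Local Open Scope ring_scope.

Record sgraph := SGraph {
  vertex :> finType;
  adj : rel vertex;
  adj_sym : symmetric adj;
  adj_irr : irreflexive adj
}.

Definition hypercube_adj (d : nat) : rel (d.-tuple bool) :=
  fun x y => #|[pred i : 'I_d | tnth x i != tnth y i]| == 1%N.

Lemma hypercube_adj_sym d : symmetric (@hypercube_adj d).
Proof.
move=> x y; rewrite /hypercube_adj; congr (_ == _); apply: eq_card => i.
by rewrite !inE eq_sym.
Qed.

Lemma hypercube_adj_irr d : irreflexive (@hypercube_adj d).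
Proof.
move=> x; rewrite /hypercube_adj eq_card0 // => i.
by rewrite !inE eqxx.
Qed.

Definition hypercube (d : nat) : sgraph :=
  SGraph (@hypercube_adj_sym d) (@hypercube_adj_irr d).

(* For [k = 0] the empty product is a single point, so a graph has cubicity 0
   exactly when it is complete. *)
Definition unit_cube (R : realType) (k : nat) (a : 'rV[R]_k) : set 'rV[R]_k :=
  [set p | forall i : 'I_k, `[a 0 i, a 0 i + 1]%classic (p 0 i)].

Definition is_cube (R : realType) (k : nat) (C : set 'rV[R]_k) : Prop :=
  exists a : 'rV[R]_k, C = unit_cube a.

Definition intersection_model (U : Type) (G : sgraph) (S : G -> set U) : Prop :=
  forall x y : G, x != y -> (adj x y <-> S x `&` S y !=set0).

Definition cube_representable (R : realType) (G : sgraph) (k : nat) : Prop :=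
  exists S : G -> set 'rV[R]_k,
    (forall x, is_cube (S x)) /\ intersection_model S.

(* One coordinate per vertex [v]: the interval of [v] starts at 0, those of its
   neighbours at 1 and all others at 2. *)
Lemma cube_representable_ex (R : realType) (G : sgraph) :
  exists k, `[< cube_representable R G k >].
Proof.
pose f (v x : G) : R := if x == v then 0 else if adj v x then 1 else 2.
have f_le2 v x : f v x <= 2.
  by rewrite /f; case: ifP => // _; case: ifP => // _; rewrite ler1n.
exists #|G|; apply/asboolP.
pose a (x : G) : 'rV[R]_#|G| := \row_i f (enum_val i) x.
exists (fun x => unit_cube (a x)); split; first by move=> x; exists (a x).
move=> x y xy; split => [Axy | [p [px py]]].
- exists (\row_i Num.max (f (enum_val i) x) (f (enum_val i) y)).
  suff f1 v : f v x <= f v y + 1 /\ f v y <= f v x + 1.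
    split=> i /=; have [h1 h2] := f1 (enum_val i);
      by rewrite in_itv /= !mxE le_max ge_max lexx ?orbT /= ?lerDl ?ler01 ?h1 ?h2.
  have le2 (b : R) : 1 <= b -> 2 <= b + 1 by move=> ?; rewrite -[2]/(1 + 1) lerD2r.
  have [xv|xv] := eqVneq x v.
    by subst v; rewrite /f eqxx eq_sym (negbTE xy) Axy add0r lexx; split.
  have [yv|yv] := eqVneq y v.
    by subst v; rewrite /f eqxx (negbTE xy) adj_sym Axy add0r lexx; split.
  have f_ge1 z : z != v -> 1 <= f v z.
    by move=> /negbTE zv; rewrite /f zv; case: ifP => // _; rewrite ler1n.
  by split; apply: (le_trans (f_le2 _ _)); apply: le2; apply: f_ge1.
- have := px (enum_rank x); have := py (enum_rank x).
  rewrite /= !in_itv /= !mxE enum_rankK /f eqxx eq_sym (negbTE xy).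
  case: ifP => // _ /andP[h1 _] /andP[_ h2].
  by have := le_trans h1 h2; rewrite add0r lern1.
Qed.

Definition cubicity (R : realType) (G : sgraph) : nat :=
  ex_minn (cube_representable_ex R G).

(* Main.v *)
(* A graph has cubicity at most k iff it has k real functions whose differences
   are all at most 1 in absolute value exactly along the edges.

   Lower bound: these functions are 1-Lipschitz for the graph distance, so the
   hypercube is mapped into a cube of side 2d.  Cut it into (2d+1)^k cells of side
   1; vertices in a common cell are pairwise adjacent, and the hypercube is
   bipartite, so a cell holds at most two of them and 2^d <= 2 (2d+1)^k.

   Upper bound: use the Hamming distances to k = O(d / log d) random landmarks.
   They are 1-Lipschitz, so it suffices that for all x, y at distance m >= 2 some
   landmark has distances to x and y that differ by at least 2.  One random
   landmark fails with probability about 1/sqrt m, by the central binomial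
   estimate, and this event depends only on the set D where x and y differ and on
   the restriction of x to D, so a union bound over such data works. *)
Require Import Defs.
From mathcomp Require Import all_boot zify.
Set Implicit Arguments.
Unset Strict Implicit.
Unset Printing Implicit Defensive.

(** * Central binomial coefficients and balanced subsets *)

Lemma leq_exp2r_weak m n k : m <= n -> m ^ k <= n ^ k.
Proof. by case: (posnP k) => [-> //|k0]; rewrite leq_exp2r. Qed.

Lemma central_bin_rec n : n.+1 * 'C(n.+1.*2, n.+1) = (n.*2.+1).*2 * 'C(n.*2, n).
Proof.
have h1 := mul_bin_diag n.*2.+2 n; have h2 := mul_bin_down n.*2.+1 n.
rewrite doubleS /= in h1 h2 *; rewrite -h1.
have e : n.*2.+1 - n = n.+1 by lia.
rewrite e in h2; apply/eqP; rewrite -(eqn_pmul2l (ltn0Sn n)).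
by apply/eqP; nia.
Qed.

(** By [central_bin_rec] the induction step reduces to [(2n+1)(2n+3) <= (2n+2)^2]. *)
Lemma central_bin_bound n : n.*2.+1 * 'C(n.*2, n) ^ 2 <= 16 ^ n.
Proof.
elim: n => [|n IH] //.
have h := central_bin_rec n.
rewrite -(leq_pmul2l (_ : 0 < n.+1 ^ 2)) ?expn_gt0 // [16 ^ _]expnS.
have -> : n.+1 ^ 2 * (n.+1.*2.+1 * 'C(n.+1.*2, n.+1) ^ 2) =
   n.+1.*2.+1 * (n.+1 * 'C(n.+1.*2, n.+1)) ^ 2 by rewrite expnMn; lia.
rewrite h; move: IH; set C := 'C(_, _); set P := 16 ^ n => IH.
have -> : n.+1.*2.+1 * ((n.*2.+1).*2 * C) ^ 2 =
   (4 * (n.+1.*2.+1 * n.*2.+1)) * (n.*2.+1 * C ^ 2) by rewrite !expnS; lia.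
rewrite [X in _ <= X]mulnA; apply: leq_mul => //; rewrite !expnS; nia.
Qed.

(* The number of subsets of an m-set whose size differs by at most one from the
   size of their complement: the factor [(odd m).+1] counts the one or two
   middle sizes, [m./2] and [uphalf m]. *)
Definition balanced_count m := 'C(m, m./2) * (odd m).+1.

Lemma balanced_count_even n : balanced_count n.*2 = 'C(n.*2, n).
Proof. by rewrite /balanced_count odd_double doubleK muln1. Qed.

Lemma balanced_count_odd n : balanced_count n.*2.+1 = 'C(n.+1.*2, n.+1).
Proof.
rewrite /balanced_count /= odd_double uphalf_double doubleS binS.
rewrite -[X in _ = X + _]bin_sub; last by lia.
have -> : n.*2.+1 - n.+1 = n by lia.
lia.
Qed.

Lemma four_pow_double n : 4 ^ n.*2 = 16 ^ n.
Proof. by rewrite -mul2n expnM. Qed.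

(** The first estimate decays with [m] but is trivial at [m = 2]; the second gives a fixed factor
    below 1 for every [m > 1]. *)
Lemma balanced_count_bound m : 1 < m ->
  (m + 2) * balanced_count m ^ 2 <= 4 * 4 ^ m /\
  5 * balanced_count m ^ 2 <= 4 * 4 ^ m.
Proof.
rewrite -(odd_double_half m); case: (odd m); move: m./2 => n.
  rewrite add1n balanced_count_odd [4 ^ _]expnS four_pow_double => n1.
  have := central_bin_bound n.+1; rewrite [16 ^ _]expnS.
  set C := 'C(_, _); nia.
rewrite add0n balanced_count_even four_pow_double => n1.
have := central_bin_bound n; set C := 'C(_, _); nia.
Qed.

(** * Landmark sets resolving the hypercube *)

Section Landmarks.
Variable T : finType.
Implicit Types A B D E s X Y : {set T}.

(** Strings are encoded as subsets; the cardinality is then the Hamming distance. *)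
Definition symdiff A X := [set i | (i \in A) (+) (i \in X)].

Definition balanced D B := (#|B| <= #|D :\: B| + 1) && (#|D :\: B| <= #|B| + 1).

Lemma symdiffC A X : symdiff A X = symdiff X A.
Proof. by apply/setP => i; rewrite !inE addbC. Qed.

Lemma card_balanced D :
  #|[set E : {set T} | (E \subset D) && balanced D E]| <= balanced_count #|D|.
Proof.
have sub : [set E : {set T} | (E \subset D) && balanced D E] \subset
    [set E : {set T} | E \subset D & #|E| == #|D|./2] :|:
    [set E : {set T} | E \subset D & #|E| == uphalf #|D| ].
  apply/subsetP => E; rewrite !inE => /andP[ED /andP[h1 h2]]; rewrite ED /=.
  rewrite !cardsDS // in h1 h2; have := subset_leq_card ED.
  by rewrite uphalf_half; have := odd_double_half #|D|; lia.
rewrite /balanced_count.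
have [o|e] := boolP (odd #|D|); last first.
  rewrite uphalf_half (negbTE e) add0n setUid in sub.
  by rewrite muln1; apply: leq_trans (subset_leq_card sub) _; rewrite cards_draws.
apply: leq_trans (subset_leq_card sub) _; apply: leq_trans (leq_card_setU _ _) _.
rewrite !cards_draws uphalf_half o muln2 -addnn leq_add2l -bin_sub; last first.
  by have := odd_double_half #|D|; lia.
rewrite (_ : #|D| - _ = #|D|./2) //.
by have := odd_double_half #|D|; rewrite o; lia.
Qed.

(* For [D = symdiff X Y] and [s = D :&: X], the landmarks whose Hamming distances
   to [X] and [Y] differ by at most 1. *)
Definition blind D s := [set A | balanced D (D :&: symdiff A s)].

(** A blind set is determined by its trace on [D], balanced after a shift by [s], and by an
    arbitrary part outside [D]. *)
Lemma card_blind D s : #|blind D s| <= balanced_count #|D| * 2 ^ (#|T| - #|D|).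
Proof.
pose phi A := (D :&: symdiff A s, A :\: D).
have phi_inj : injective phi.
  move=> A B [/setP h1 /setP h2]; apply/setP => i.
  have := h1 i; have := h2 i; rewrite !inE.
  by case: (i \in D) => //= _; case: (i \in A) (i \in B) (i \in s) => [] [] [].
rewrite -(card_imset _ phi_inj).
have sub : phi @: blind D s \subset
   setX [set E : {set T} | (E \subset D) && balanced D E] (powerset (~: D)).
  apply/subsetP => _ /imsetP[A + ->]; rewrite !inE /phi /= => h.
  by rewrite subsetIl h /= setDE subsetIr.
apply: leq_trans (subset_leq_card sub) _.
rewrite cardsX card_powerset [#|~: D|]cardsCs setCK.
by rewrite leq_mul2r card_balanced orbT.
Qed.

(** Points outside [D] add equally to both distances, and inside [D] the two differences are
    complementary. *)
Lemma symdiff_blind A X Y :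
  #|symdiff A X| <= #|symdiff A Y| + 1 -> #|symdiff A Y| <= #|symdiff A X| + 1 ->
  A \in blind (symdiff X Y) (symdiff X Y :&: X).
Proof.
rewrite !inE; set D := symdiff X Y; set B := symdiff A X; set C := symdiff A Y.
have -> : D :&: symdiff A (D :&: X) = B :&: D.
  by apply/setP => i; rewrite !inE; do 3!case: (i \in _).
have DB : D :\: (B :&: D) = C :&: D.
  by apply/setP => i; rewrite !inE; do 3!case: (i \in _).
have CB : C :\: D = B :\: D.
  by apply/setP => i; rewrite !inE; do 3!case: (i \in _).
rewrite /balanced DB -(cardsID D B) -(cardsID D C) CB => h1 h2.
by apply/andP; split; lia.
Qed.

Lemma card_bigcup_le (I : finType) (P : pred I) (S : finType) (F : I -> {set S}) :
  #|\bigcup_(i | P i) F i| <= \sum_(i | P i) #|F i|.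
Proof.
elim/big_rec2: _ => [|i n A _ h]; first by rewrite cards0.
by apply: leq_trans (leq_card_setU _ _) _; rewrite leq_add2l.
Qed.

Lemma sum_set_by_card (P : pred nat) (F : nat -> nat) :
  \sum_(D : {set T} | P #|D|) F #|D| = \sum_(m < #|T|.+1 | P m) 'C(#|T|, m) * F m.
Proof.
rewrite (partition_big (fun D : {set T} => inord #|D| : 'I_#|T|.+1)
  (fun m : 'I_#|T|.+1 => P m)) /=; last first.
  by move=> D PD; rewrite inordK // ltnS max_card.
apply: eq_bigr => m Pm; have := cards_draws [set: T] m; rewrite cardsT => <-.
rewrite -sum_nat_const.
apply: eq_big => [D|D /andP[_ /eqP <-]]; last by rewrite inordK // ltnS max_card.
rewrite !inE subsetT /= -val_eqE /= inordK ?ltnS ?max_card // andbC.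
by case: eqP => // ->.
Qed.

Definition resolving k (F : 'I_k -> {set T}) := forall X Y, 1 < #|symdiff X Y| ->
  exists i, (#|symdiff (F i) X| + 1 < #|symdiff (F i) Y|) ||
            (#|symdiff (F i) Y| + 1 < #|symdiff (F i) X|).

(* Union bound: a k-tuple fails to resolve X and Y only if all its entries are
   blind for the pair (D, D :&: X), where D is the symmetric difference. *)
Lemma resolving_ex k :
  \sum_(m < #|T|.+1 | 1 < m)
     'C(#|T|, m) * (2 ^ m * (balanced_count m * 2 ^ (#|T| - m)) ^ k)
    < (2 ^ #|T|) ^ k ->
  exists F : 'I_k -> {set T}, resolving F.
Proof.
move=> small.
pose bad := \bigcup_(p : {set T} * {set T} | (1 < #|p.1|) && (p.2 \subset p.1))
  [set F : {ffun 'I_k -> {set T}} | F \in ffun_on (mem (blind p.1 p.2))].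
have bad_small : #|bad| < #|{ffun 'I_k -> {set T}}|.
  rewrite card_ffun card_ord -cardsT -powersetT card_powerset cardsT.
  apply: leq_ltn_trans small; apply: leq_trans (card_bigcup_le _ _) _.
  rewrite -(pair_big_dep (fun D : {set T} => 1 < #|D|)
    (fun D s : {set T} => s \subset D)
    (fun D s => #|[set F : {ffun 'I_k -> {set T}} |
                    F \in ffun_on (mem (blind D s))]|)) /=.
  rewrite -(sum_set_by_card (fun m => 1 < m)
    (fun m => 2 ^ m * (balanced_count m * 2 ^ (#|T| - m)) ^ k)).
  apply: leq_sum => D _; rewrite -card_powerset -sum_nat_const.
  rewrite (eq_bigl (fun s => s \in powerset D)); last by move=> s; rewrite inE.
  apply: leq_sum => s _; rewrite cardsE card_ffun_on card_ord.
  by rewrite leq_exp2r_weak // card_blind.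
have : bad != setT by apply: contraTneq bad_small => ->; rewrite cardsT ltnn.
rewrite -subTset => /subsetPn[F _ /bigcupP Fbad].
exists F => X Y D2; apply/existsP; apply: contra_notT Fbad => /existsPn h.
exists (symdiff X Y, symdiff X Y :&: X); first by rewrite /= D2 subsetIl.
rewrite inE; apply/ffun_onP => i.
have := h i; rewrite negb_or -!leqNgt => /andP[h1 h2].
exact: symdiff_blind.
Qed.

End Landmarks.

(** * Numerical estimates for the union bound *)

Lemma bin_leq_expn n m : 'C(n, m) <= n ^ m.
Proof.
apply: leq_trans (_ : n ^_ m <= _); first by rewrite -bin_ffact leq_pmulr ?fact_gt0.
elim: m n => [|m IH] [|n] //; rewrite ffactSS expnS leq_mul2l /=.
by apply: leq_trans (IH n) _; rewrite leq_exp2r_weak.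
Qed.

Lemma bin_leq_exp2 n m : 'C(n, m) <= 2 ^ n.
Proof.
have [nm|mn] := ltnP n m; first by rewrite bin_small.
rewrite -[2]/(1 + 1) expnDn (bigD1 (inord m)) //= inordK ?ltnS //.
by rewrite !exp1n !muln1 leq_addr.
Qed.

(** Since [(4/5)^4 < 1/2], every eight factors gain a factor 2. *)
Lemma balanced_count_small m J : 1 < m ->
  2 ^ J * balanced_count m ^ (8 * J) <= (2 ^ m) ^ (8 * J).
Proof.
case/balanced_count_bound => _ h.
rewrite ![_ ^ (8 * J)]expnM -expnMn leq_exp2r_weak //.
rewrite -[8]/(2 * 4) !(expnM _ 2 4) -(expnM 2 m 2) (mulnC m) (expnM 2 2 m).
have := leq_exp2r_weak 4 h; rewrite (expnMn 5) (expnMn 4).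
move: ((balanced_count m ^ 2) ^ 4) ((4 ^ m) ^ 4) => y x; lia.
Qed.

Lemma balanced_count_large m e J : 4 * 2 ^ e <= m ->
  2 ^ (4 * (e * J)) * balanced_count m ^ (8 * J) <= (2 ^ m) ^ (8 * J).
Proof.
move=> em; have e0 := expn_gt0 2 e.
have [|h _] := @balanced_count_bound m; first by lia.
rewrite mulnA ![_ ^ (_ * J)]expnM -expnMn leq_exp2r_weak //.
rewrite -[8]/(2 * 4) !(expnM _ 2 4) -(expnM 2 m 2) (mulnC m) (expnM 2 2 m).
rewrite (mulnC 4 e) (expnM 2 e 4) -expnMn leq_exp2r_weak //.
move: h; move: (_ ^ 2) (4 ^ m) => y x h.
by rewrite -(leq_pmul2l (isT : 0 < 4)) mulnA (leq_trans _ h) // leq_mul2r; lia.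
Qed.

(* Below the threshold [4 * 2 ^ e] there are few pairs [(D, s)] with [#|D| = m];
   above it, [balanced_count m / 2 ^ m] is at most [2 ^ (- e / 2)]. *)
Lemma union_bound_term d l e J m : 1 < m <= d -> d < 2 ^ l ->
  l + l.+1 * (4 * 2 ^ e) <= J -> l + 2 * d <= 4 * (e * J) ->
  d.+1 * ('C(d, m) * (2 ^ m * (balanced_count m * 2 ^ (d - m)) ^ (8 * J)))
    <= (2 ^ d) ^ (8 * J).
Proof.
move=> /andP[m1 md] dl hs hl.
have -> : (2 ^ d) ^ (8 * J) = (2 ^ m) ^ (8 * J) * (2 ^ (d - m)) ^ (8 * J).
  by rewrite -expnMn -expnD subnKC.
rewrite expnMn 3!mulnA leq_mul2r; apply/orP; right.
have [small|large] := leqP m (4 * 2 ^ e).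
  apply: leq_trans (balanced_count_small _ m1); rewrite leq_mul2r; apply/orP; right.
  (* The exponent [l + (l + 1) m] is at most [J] because [m <= 4 * 2 ^ e]. *)
  apply: leq_trans (_ : 2 ^ l * (2 ^ l) ^ m * 2 ^ m <= _).
    rewrite leq_mul2r leq_mul ?orbT // (leq_trans (bin_leq_expn _ _)) //.
    by rewrite leq_exp2r ltnW // ltnW.
  rewrite -expnM -!expnD leq_exp2l //; nia.
apply: leq_trans (balanced_count_large J (ltnW large)).
rewrite leq_mul2r; apply/orP; right.
apply: leq_trans (_ : 2 ^ l * 2 ^ d * 2 ^ d <= _).
  by rewrite !leq_mul ?bin_leq_exp2 // leq_exp2l.
rewrite -!expnD leq_exp2l //; lia.
Qed.

(** The index [m = 0] contributes nothing, so at most [d] terms remain, each at most a [1 / (d + 1)]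
    share: hence the strict inequality. *)
Lemma union_bound d k :
  (forall m, 1 < m <= d -> d.+1 *
     ('C(d, m) * (2 ^ m * (balanced_count m * 2 ^ (d - m)) ^ k)) <= (2 ^ d) ^ k) ->
  \sum_(m < d.+1 | 1 < m)
     'C(d, m) * (2 ^ m * (balanced_count m * 2 ^ (d - m)) ^ k) < (2 ^ d) ^ k.
Proof.
move=> h; rewrite -(ltn_pmul2l (ltn0Sn d)) big_mkcond big_ord_recl /= add0n.
apply: leq_ltn_trans (_ : d * (2 ^ d) ^ k < _); last first.
  by rewrite ltn_pmul2r // !expn_gt0.
rewrite big_distrr /= -[X in _ <= X * _]card_ord -sum_nat_const leq_sum // => i _.
by case: ifP => [i1|_]; [apply: h; rewrite i1 ltn_ord | rewrite muln0].
Qed.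

Lemma trunc_log_unbounded n :
  exists d0, 3 <= d0 /\ forall d, d0 <= d -> n <= trunc_log 2 d.
Proof.
exists (2 ^ n.+2); split=> [|d nd]; first by rewrite (@leq_trans (2 ^ 2)) // leq_exp2l.
apply: (@leq_trans n.+2); last exact: trunc_log_max.
by rewrite ltnW.
Qed.

(** The polynomial comes from the condition on [J] for small [m] in [resolving_few], where [e] is
    half of the logarithm: hence the threshold 20 there. *)
Lemma quadratic_leq_exp2 e : 10 <= e -> 8 * e ^ 2 + 16 * e <= 2 ^ e.
Proof.
elim: e => // e IH; rewrite leq_eqVlt => /predU1P[<-|e10]; first exact: isT.
by have := IH e10; rewrite [2 ^ e.+1]expnS; nia.
Qed.

Lemma resolving_few d : 20 <= trunc_log 2 d ->
  exists k (F : 'I_k -> {set 'I_d}),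
    resolving F /\ k * (trunc_log 2 d).+1 <= 48 * d.
Proof.
set L := trunc_log 2 d => L20.
have d0 : 0 < d by case: d @L L20 => //.
have /andP[dL Ld] := trunc_log_bounds (isT : 1 < 2) d0; rewrite -/L in dL Ld.
(* With [2 ^ e] of order [sqrt d], the small [m] only need [J] of order [sqrt d * log d]; taking [J]
   just above [d / e] also covers the large ones. *)
pose e := L./2; have e10 : 10 <= e by rewrite /e; lia.
have Le : e.*2 <= L <= e.*2.+1 by rewrite /e; lia.
pose J := (d %/ e).+1.
have dJ : d < e * J by rewrite mulnC ltn_ceil //; lia.
have Jd : e * J <= d + e by rewrite mulnS addnC leq_add2r mulnC leq_trunc_div.
have Ld' : L.+1 <= d by apply: leq_trans dL; exact: ltn_expl.
have hs : L.+1 + L.+2 * (4 * 2 ^ e) <= J.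
  apply: ltnW; rewrite ltnS leq_divRL; last by lia.
  apply: leq_trans dL; apply: leq_trans (_ : 2 ^ e * 2 ^ e <= _); last first.
    by rewrite -expnD leq_exp2l // addnn; case/andP: Le.
  have := quadratic_leq_exp2 e10; set p := 2 ^ e => hp.
  apply: leq_trans (_ : (8 * e ^ 2 + 16 * e) * p <= _); last by rewrite leq_mul2r hp orbT.
  have : L.+1 <= 4 * p by nia.
  by nia.
exists (8 * J).
have [|F resF] := @resolving_ex 'I_d (8 * J).
  rewrite card_ord; apply: union_bound => m hm.
  by apply: (union_bound_term hm Ld hs); lia.
by exists F; split=> //; nia.
Qed.

From HB Require Import structures.
From mathcomp Require Import all_order all_algebra lra.
From mathcomp Require Import all_classical all_reals all_analysis.
Import Order.TTheory GRing.Theory Num.Theory.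
Local Open Scope ring_scope.

(** * From landmarks to cubes, and the volume bound *)

Lemma unit_cube_meet (R : realType) k (a b : 'rV[R]_k) :
  (unit_cube a `&` unit_cube b !=set0)%classic <->
  forall i, `|a 0 i - b 0 i| <= 1.
Proof.
split=> [[p [pa pb]] i | h].
  have := pa i; have := pb i; rewrite /= !in_itv /= ler_norml.
  by move=> /andP[? ?] /andP[? ?]; apply/andP; split; lra.
exists (\row_i Num.max (a 0 i) (b 0 i)); split=> i /=;
  have := h i; rewrite in_itv /= !mxE le_max ge_max lexx ?orbT /= ler_norml;
  by move=> /andP[? ?]; apply/andP; split; lra.
Qed.

Lemma cube_representableP (R : realType) (G : sgraph) k :
  cube_representable R G k <->
  exists a : G -> 'rV[R]_k, forall x y : G, x != y ->
    (adj x y <-> forall i, `|a x 0 i - a y 0 i| <= 1).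
Proof.
split=> [[S [cubeS adjS]] | [a adja]].
  have [a Sa] := choice cubeS.
  by exists a => x y xy; rewrite adjS // !Sa unit_cube_meet.
exists (fun x => unit_cube (a x)); split; first by move=> x; exists (a x).
by move=> x y xy; rewrite unit_cube_meet; exact: adja.
Qed.

Lemma cubicity_representable (R : realType) (G : sgraph) :
  cube_representable R G (cubicity R G).
Proof. by rewrite /cubicity; case: ex_minnP => k /asboolP. Qed.

Lemma cubicity_le (R : realType) (G : sgraph) k :
  cube_representable R G k -> (cubicity R G <= k)%N.
Proof. by move=> h; rewrite /cubicity; case: ex_minnP => n _; apply; exact/asboolP. Qed.

Definition tuple_set d (x : d.-tuple bool) : {set 'I_d} := [set i | tnth x i]%SET.

Definition set_tuple d (E : {set 'I_d}) : d.-tuple bool := [tuple i \in E | i < d].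

Lemma set_tupleK d : cancel (@set_tuple d) (@tuple_set d).
Proof. by move=> E; apply/setP => i; rewrite inE tnth_mktuple. Qed.

Lemma tuple_setK d : cancel (@tuple_set d) (@set_tuple d).
Proof. by move=> x; apply: eq_from_tnth => i; rewrite tnth_mktuple inE. Qed.

Lemma hypercube_adjE d (x y : hypercube d) :
  adj x y = (#|symdiff (tuple_set x) (tuple_set y)| == 1%N).
Proof.
congr (_ == _); apply: eq_card => i.
by rewrite !inE; case: (tnth x i) (tnth y i) => [] [].
Qed.

Lemma card_symdiff (T : finType) (A B : {set T}) :
  #|symdiff A B| = (#|A :\: B| + #|B :\: A|)%N.
Proof.
have -> : symdiff A B = ((A :\: B) :|: (B :\: A))%SET.
  by apply/setP => i; rewrite !inE; do 2!case: (i \in _).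
rewrite cardsU (_ : (_ :&: _)%SET = finset.set0) ?cards0 ?subn0 //.
by apply/setP => i; rewrite !inE; do 2!case: (i \in _).
Qed.

(** Common elements are counted twice. Adjacent vertices thus have opposite parity, which is the
    bipartiteness of the hypercube. *)
Lemma odd_symdiff (T : finType) (A B : {set T}) :
  odd #|symdiff A B| = odd #|A| (+) odd #|B|.
Proof.
rewrite card_symdiff -(cardsID B A) -(cardsID A B) finset.setIC !oddD.
by do 3!case: (odd _).
Qed.

Lemma symdiff_lipschitz (T : finType) (A X Y : {set T}) :
  (#|symdiff A X| <= #|symdiff A Y| + #|symdiff X Y|)%N.
Proof.
apply: leq_trans (leq_card_setU _ _); apply: subset_leq_card.
by apply/fintype.subsetP => i; rewrite !inE; do 3!case: (i \in _).
Qed.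

(** With the distances to the landmarks as coordinates, the triangle inequality keeps edges short
    and resolution separates vertices at distance at least 2. *)
Lemma resolving_representable (R : realType) d k (F : 'I_k -> {set 'I_d}) :
  resolving F -> cube_representable R (hypercube d) k.
Proof.
move=> resF; apply/cube_representableP.
exists (fun x : hypercube d => \row_i #|symdiff (F i) (tuple_set x)|%:R) => x y xy.
rewrite hypercube_adjE; split=> [/eqP xy1 i | close].
  have := symdiff_lipschitz (F i) (tuple_set x) (tuple_set y).
  have := symdiff_lipschitz (F i) (tuple_set y) (tuple_set x).
  rewrite (symdiffC (tuple_set y)) xy1 !mxE -!(ler_nat R) !natrD => h1 h2.
  by rewrite ler_norml; apply/andP; split; lra.
rewrite eqn_leq; apply/andP; split.
  rewrite leqNgt; apply/negP => /resF[i]; have := close i; rewrite !mxE ler_norml.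
  move=> /andP[h1 h2] /orP[]; rewrite -(ltr_nat R) natrD; lra.
rewrite card_gt0; apply: contraNneq xy => /setP e; apply/eqP.
apply: (can_inj (@tuple_setK d)); apply/setP => i.
by have := e i; rewrite !inE; do 2!case: (tnth _ _).
Qed.

(** * Lower bound by counting cells *)

Section LowerBound.
Variables (R : realType) (d k : nat) (a : hypercube d -> 'rV[R]_k).
Hypothesis adja : forall x y : hypercube d, x != y ->
  (adj x y <-> forall i, `|a x 0 i - a y 0 i| <= 1).

Let pos (E : {set 'I_d}) i := a (set_tuple E) 0 i - a (set_tuple finset.set0) 0 i.

(** Removing the elements of [E] one by one walks along edges to the empty set, whose position is
    0. *)
Lemma pos_bound E i : `|pos E i| <= #|E|%:R.
Proof.
elim: {E}_.+1 {-2}E (ltnSn #|E|) => // n IH E.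
have [->|/set0Pn[j jE]] := eqVneq E finset.set0.
  by rewrite /pos subrr normr0 ler0n.
rewrite (cardsD1 j) jE add1n !ltnS => /IH h.
have : `|a (set_tuple E) 0 i - a (set_tuple (E :\ j)%SET) 0 i| <= 1.
  apply: (proj1 (@adja _ _ _)).
    apply/eqP => /(can_inj (@set_tupleK d)) /setP /(_ j).
    by rewrite !inE jE eqxx.
  rewrite hypercube_adjE !set_tupleK; apply/cards1P; exists j.
  apply/setP => l; rewrite !inE; case: (eqVneq l j) => [->|_]; last exact: addbb.
  by rewrite jE.
move: h; rewrite /pos -natr1 !ler_norml => /andP[? ?] /andP[? ?].
by apply/andP; split; lra.
Qed.

(** Shifting by [d] brings the coordinates into [[0, 2d]], so truncation is a floor and [inord]
    loses nothing. *)
Let cell (E : {set 'I_d}) : {ffun 'I_k -> 'I_d.*2.+1} * bool :=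
  ([ffun i => inord (Num.truncn (pos E i + d%:R))], odd #|E|).

(* Two vertices in the same cell of side 1 are equal or adjacent, and adjacent
   vertices have supports of different parity. *)
Lemma cell_inj : injective cell.
Proof.
move=> E E' [/ffunP same par]; apply/eqP; apply: contraTT isT => EE' /=.
have neq : set_tuple E != set_tuple E'.
  by apply: contra EE' => /eqP /(can_inj (@set_tupleK d)) ->.
suff : adj (set_tuple E : hypercube d) (set_tuple E' : hypercube d).
  rewrite hypercube_adjE !set_tupleK => /eqP /(congr1 odd).
  by rewrite odd_symdiff par addbb.
apply/(adja neq) => i.
have range (B : {set 'I_d}) : 0 <= pos B i + d%:R <= d.*2%:R.
  have : `|pos B i| <= d%:R.
    by rewrite (le_trans (pos_bound B i)) // ler_nat -[leqRHS]card_ord max_card.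
  by rewrite ler_norml -addnn natrD => /andP[? ?]; apply/andP; split; lra.
have small (B : {set 'I_d}) : (Num.truncn (pos B i + d%:R) < d.*2.+1)%N.
  by have /andP[h0 h1] := range B; rewrite truncn_lt_nat // -natr1; lra.
have := congr1 (@nat_of_ord _) (same i); rewrite !ffunE !inordK // => e.
have /andP[h0 _] := range E; have /andP[h0' _] := range E'.
have := truncn_itv h0; have := truncn_itv h0'; rewrite e -!natr1 /pos ler_norml.
by move=> /andP[? ?] /andP[? ?]; apply/andP; split; lra.
Qed.

Lemma volume_bound : (2 ^ d <= d.*2.+1 ^ k * 2)%N.
Proof.
have := leq_card _ cell_inj.
rewrite card_prod card_ffun !card_ord card_bool.
by rewrite -cardsT -powersetT card_powerset cardsT card_ord.
Qed.

End LowerBound.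

(** * Bounds in terms of [d / ln d] *)

Lemma cubicity_hypercube_lower (R : realType) d : (3 <= d)%N ->
  ln 2 / 4 * (d%:R / ln d%:R) <= (cubicity R (hypercube d))%:R :> R.
Proof.
move=> d3; set k := cubicity _ _; have d0 : (0 < d)%N by lia.
have /cube_representableP[a adja] := cubicity_representable R (hypercube d).
have lnd : 0 < ln d%:R :> R by rewrite ln_gt0 // ltr1n; lia.
have ln2 : 0 < ln 2 :> R by rewrite ln_gt0 // ltr1n.
(* For [d >= 3], [2d + 1 <= d^2]. The 4 in the constant comes from this square and from
   [d <= 2(d - 1)]. *)
have : (2 ^ d.-1 <= d ^ (2 * k))%N.
  rewrite -(leq_pmul2r (isT : (0 < 2)%N)) -expnSr prednK; last by lia.
  apply: leq_trans (volume_bound adja) _.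
  rewrite leq_mul2r expnM leq_exp2r_weak //=.
  rewrite -mulnn -muln2.
  by apply: leq_trans (_ : d * 3 <= _)%N; [lia | rewrite leq_mul2l d3 orbT].
rewrite -(ler_nat R) => h; rewrite -ler_ln ?posrE ?ltr0n ?expn_gt0 ?d0 // in h.
move: h; rewrite !natrX !lnXn ?ltr0n // -!(mulr_natl (ln _)) natrM => h.
have d1 : d%:R <= 2 * d.-1%:R :> R by rewrite -natrM ler_nat; lia.
rewrite mulrA ler_pdivrMr //; nra.
Qed.

Lemma cubicity_hypercube_upper (R : realType) d : (20 <= trunc_log 2 d)%N ->
  (cubicity R (hypercube d))%:R <= 48 * ln 2 * (d%:R / ln d%:R) :> R.
Proof.
move=> L20; have d1 : (1 < d)%N by case: d L20 => [|[|d]].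
have [k [F [resF kd]]] := resolving_few L20.
have lnd : 0 < ln d%:R :> R by rewrite ln_gt0 // ltr1n.
have ln2 : 0 < ln 2 :> R by rewrite ln_gt0 // ltr1n.
apply: (@le_trans _ _ k%:R).
  by rewrite ler_nat cubicity_le //; exact: resolving_representable resF.
rewrite mulrA ler_pdivlMr //.
(* This change of base puts [ln 2] into the constant. *)
have lnd_le : ln d%:R <= (trunc_log 2 d).+1%:R * ln 2 :> R.
  rewrite mulr_natl -lnXn // ler_ln ?posrE ?ltr0n ?exprn_gt0 // ?ltr0n ?(ltnW d1) //.
  by rewrite -natrX ler_nat ltnW // trunc_log_ltn.
move: kd; rewrite -(ler_nat R) !natrM => kd.
apply: le_trans (ler_wpM2l (ler0n _ _) lnd_le) _.
by rewrite mulrA -!mulrA [ln 2 * _]mulrC !mulrA ler_wpM2r // ltW.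
Qed.

Theorem theorem3 (R : realType) :
  exists (c1 c2 : R) (d0 : nat),
    [/\ 0 < c1, 0 < c2, (2 <= d0)%N &
      forall d : nat, (d0 <= d)%N ->
        c1 * (d%:R / ln d%:R) <= (cubicity R (hypercube d))%:R
        /\ (cubicity R (hypercube d))%:R <= c2 * (d%:R / ln d%:R)].
Proof.
have ln2 : 0 < ln 2 :> R by rewrite ln_gt0 // ltr1n.
have [d0 [d0_ge3 d0_log]] := trunc_log_unbounded 20.
exists (ln 2 / 4), (48 * ln 2), d0; split.
- by rewrite divr_gt0.
- by rewrite mulr_gt0.
- exact: ltnW.
move=> d d0d; split; last exact/cubicity_hypercube_upper/d0_log.
by apply: cubicity_hypercube_lower; exact: leq_trans d0d.
Qed.
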